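(* Let $I\subset\mathbb{R}$ be a nondegenerate interval, let $n\in\mathbb{N}$, let $\omega=(\omega_1,\dots,\omega_n):I\to\mathbb{R}^n$ be an $n$-dimensional positive Chebyshev system over $I$, and let $\omega_{n+1}:I\to\mathbb{R}$ be such that $\omega^*=(\omega_1,\dots,\omega_n,\omega_{n+1})$ is an $(n+1)$-dimensional positive Chebyshev system over $I$. A function $f:I\to\mathbb{R}$ is $\omega$-convex on $I$ if and only if, for all $p\in I$, $$\underline{D}_{\,\omega^*}f(p)\ge0.$$
   Context: $\mathbb{N}$ is the set of positive integers. $\sigma_k(I):=\{(x_1,\dots,x_k)\in I^k\mid x_1<\dots<x_k\}$. For $\omega=(\omega_1,\dots,\omega_k):I\to\mathbb{R}^k$ and $(x_1,\dots,x_k)\in\sigma_k(I)$, $\Phi_\omega(x_1,\dots,x_k):=\det\big(\omega_i(x_j)\big)_{i,j=1}^k$. $\omega$ is a $k$-dimensional positive Chebyshev system over $I$ if $\Phi_\omega>0$ on $\sigma_k(I)$. For an $n$-dimensional $\omega$ and $f:I\to\mathbb{R}$, $(\omega,f):=(\omega_1,\dots,\omega_n,f)$. $f$ is $\omega$-convex on $I$ if $\Phi_{(\omega,f)}\ge0$ on $\sigma_{n+1}(I)$. Put $$[x_0,\dots,x_n;f]_{\omega^*}:=\frac{\Phi_{(\omega,f)}(x_0,\dots,x_n)}{\Phi_{\omega^*}(x_0,\dots,x_n)}\qquad\text{for }(x_0,\dots,x_n)\in\sigma_{n+1}(I).$$ For $p\in I$, the lower Dinghas type derivative (an extended real number) is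 $$\underline{D}_{\,\omega^*}f(p):=\lim_{\delta\to0^+}\inf\big\{[x_0,\dots,x_n;f]_{\omega^*}: (x_0,\dots,x_n)\in\sigma_{n+1}(I),\ x_0\le p\le x_n,\ x_n-x_0<\delta\big\}.$$ *)

(* Defs.v *)
From HB Require Import structures.
From mathcomp Require Import all_boot all_order all_algebra.
From mathcomp Require Import all_classical all_reals all_analysis.
Import Order.TTheory GRing.Theory Num.Theory.
Import numFieldNormedType.Exports.

Set Implicit Arguments.
Unset Strict Implicit.
Unset Printing Implicit Defensive.

Local Open Scope classical_set_scope.
Local Open Scope ring_scope.

(* A function on the interval I is represented by a total function R -> R;     *)
(* every notion below only depends on its values on I.  Indices are shifted to *)
(* start at 0: omega_(i+1) is [w i] for [i : 'I_k].                            *)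

Definition nondegenerate_interval (R : realType) (I : set R) : Prop :=
  is_interval I /\ exists x y : R, [/\ I x, I y & x < y].

Definition sigma (R : realType) (k : nat) (I : set R) : set ('I_k -> R) :=
  [set x | (forall i, I (x i)) /\ (forall i j : 'I_k, (i < j)%N -> x i < x j)].
Arguments sigma {R} k I.

Definition Phi (R : realType) (k : nat) (w : 'I_k -> R -> R) (x : 'I_k -> R) : R :=
  \det (\matrix_(i < k, j < k) w i (x j)).

Definition positive_Chebyshev (R : realType) (k : nat) (I : set R)
    (w : 'I_k -> R -> R) : Prop :=
  forall x, sigma k I x -> 0 < Phi w x.

(* (omega_1, ..., omega_n, f) *)
Definition extend (R : realType) (n : nat) (w : 'I_n -> R -> R) (f : R -> R) :
    'I_n.+1 -> R -> R :=
  fun i => if unlift ord_max i is Some j then w j else f.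

Definition omega_convex (R : realType) (n : nat) (I : set R)
    (w : 'I_n -> R -> R) (f : R -> R) : Prop :=
  forall x, sigma n.+1 I x -> 0 <= Phi (extend w f) x.

(* [x_0, ..., x_n; f]_(omega^* ), where omega^* = (omega, v) *)
Definition divdiff (R : realType) (n : nat) (w : 'I_n -> R -> R) (v : R -> R)
    (f : R -> R) (x : 'I_n.+1 -> R) : R :=
  Phi (extend w f) x / Phi (extend w v) x.

(* The infimum is nonincreasing in delta, so the one-sided limit always exists *)
(* in the extended reals and [lim] never takes its default value.              *)
Definition lower_Dinghas (R : realType) (n : nat) (I : set R)
    (w : 'I_n -> R -> R) (v : R -> R) (f : R -> R) (p : R) : \bar R :=
  lim ((fun delta : R =>
          ereal_inf [set (divdiff w v f x)%:E | x in
            [set x | [/\ sigma n.+1 I x, x ord0 <= p, p <= x ord_max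
                       & x ord_max - x ord0 < delta]]]) @ 0^'+).

(* Main.v *)
(* If f is not omega-convex, some c > 0 makes g = f + c omega_(n+1) have       *)
(* Phi_(omega,g) <= 0 at some tuple.  Inserting a point into such a tuple      *)
(* x_0 < ... < x_n, one of the two tuples obtained by dropping the least or    *)
(* the greatest of the n + 2 points again satisfies Phi_(omega,g) <= 0.        *)
(* Inserting the points of a fine grid thus yields such tuples of arbitrarily  *)
(* small diameter inside [x_0, x_n], hence nested ones shrinking to a point p  *)
(* that each of them straddles; there the lower derivative is at most -c.      *)
Require Import Defs.
From mathcomp Require Import all_boot all_order all_algebra.
From mathcomp Require Import all_classical all_reals all_analysis.
From mathcomp Require Import ring lra zify.
Import Order.TTheory GRing.Theory Num.Theory.
Import numFieldNormedType.Exports.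

Local Open Scope classical_set_scope.
Local Open Scope ring_scope.

(** If [f] is [w]-convex, every quotient in the infimum is a nonnegative number over a positive one,
    so the lower derivative is nonnegative.

    For the converse, [Phi (extend w f) x] is linear in [f] and vanishes on the span of [w]. If the
    divided difference of [f] at some tuple is [- c < 0], then [g = f + c v] has a zero determinant
    there, and any tuple where the determinant of [g] is nonpositive has divided difference of [f]
    at most [- c]. It remains to localize such tuples. By [Phi_lift_gt0], if omitting either extreme
    point of n + 2 points gives a positive determinant, so does omitting any other point; hence
    nonpositivity survives inserting a point and discarding a suitable extreme one. A fine grid
    makes the tuples short ([Phi_le0_shrink]), and nesting them gives the point of
    [Phi_le0_at_point]. *)

(** * Determinants with one free row *)

Lemma extend_max (R : realType) (n : nat) (w : 'I_n -> R -> R) (f : R -> R) :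
  extend w f ord_max = f.
Proof. by rewrite /extend unlift_none. Qed.

Lemma extend_lift (R : realType) (n : nat) (w : 'I_n -> R -> R) (f : R -> R)
    (i : 'I_n) :
  extend w f (lift ord_max i) = w i.
Proof. by rewrite /extend liftK. Qed.

Lemma ltn_lift (n : nat) (h : 'I_n.+1) (i j : 'I_n) :
  (lift h i < lift h j)%N = (i < j)%N.
Proof. by rewrite !ltnNge /= leq_bump2. Qed.

Lemma sigma_lift (R : realType) (n : nat) (I : set R) (x : 'I_n.+1 -> R)
    (k : 'I_n.+1) :
  sigma n.+1 I x -> sigma n I (x \o lift k).
Proof.
move=> [Ix xlt]; split=> [i|i j ij] /=; first exact: Ix.
by apply: xlt; rewrite ltn_lift.
Qed.

Lemma sigma_le (R : realType) (n : nat) (I : set R) (x : 'I_n -> R) (i j : 'I_n) :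
  sigma n I x -> (i <= j)%N -> x i <= x j.
Proof.
move=> [_ xlt]; rewrite leq_eqVlt => /orP[/eqP ij|/xlt/ltW //].
by rewrite (val_inj ij).
Qed.
Arguments sigma_le {R n I x i j}.

Lemma Phi_extend_expand (R : realType) (n : nat) (w : 'I_n -> R -> R)
    (f : R -> R) (x : 'I_n.+1 -> R) :
  Phi (extend w f) x =
  \sum_k f (x k) * ((-1) ^+ (n + k) * Phi w (x \o lift k)).
Proof.
rewrite /Phi (expand_det_row _ ord_max); apply: eq_bigr => k _.
rewrite mxE extend_max /cofactor; congr (_ * (_ * \det _)).
by apply/matrixP => i j; rewrite !mxE extend_lift.
Qed.

Lemma Phi_extendD (R : realType) (n : nat) (w : 'I_n -> R -> R)
    (f g : R -> R) (c : R) (x : 'I_n.+1 -> R) :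
  Phi (extend w (fun t => f t + c * g t)) x =
  Phi (extend w f) x + c * Phi (extend w g) x.
Proof.
rewrite !Phi_extend_expand mulr_sumr -big_split /=.
by apply: eq_bigr => k _; rewrite mulrDl mulrA.
Qed.

(** With a single [w i] in the last row two rows coincide; linearity does the rest. *)
Lemma Phi_extend_span (R : realType) (n : nat) (w : 'I_n -> R -> R)
    (a : 'I_n -> R) (x : 'I_n.+1 -> R) :
  Phi (extend w (fun t => \sum_i a i * w i t)) x = 0.
Proof.
have Phiw i : Phi (extend w (w i)) x = 0.
  apply: (determinant_alternate (neq_lift ord_max i)) => j.
  by rewrite !mxE extend_max extend_lift.
rewrite Phi_extend_expand.
under eq_bigr do rewrite mulr_suml.
rewrite exchange_big big1 // => i _.
under eq_bigr do rewrite -mulrA.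
by rewrite -mulr_sumr -Phi_extend_expand Phiw mulr0.
Qed.

Lemma Phi_extend_endpoints (R : realType) (n : nat) (w : 'I_n -> R -> R)
    (h : R -> R) (x : 'I_n.+1 -> R) :
  (0 < n)%N ->
  (forall k, k != ord0 -> k != ord_max -> h (x k) = 0) ->
  Phi (extend w h) x = (-1) ^+ n * h (x ord0) * Phi w (x \o lift ord0)
                       + h (x ord_max) * Phi w (x \o lift ord_max).
Proof.
move=> n0 h0; rewrite Phi_extend_expand (bigD1 ord0) //=.
rewrite (bigD1 ord_max) /=; last first.
  by rewrite -val_eqE /= -lt0n.
rewrite big1 ?addr0 => [|k /andP[k0 kn]]; last by rewrite h0 ?mul0r.
by rewrite addn0 addnn -mul2n exprM sqrrN !expr1n mul1r; congr (_ + _); ring.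
Qed.

Lemma Chebyshev_interpolation (R : realType) (n : nat) (w : 'I_n -> R -> R)
    (u : 'I_n -> R) (g : R -> R) :
  Phi w u != 0 ->
  exists a : 'I_n -> R, forall k, g (u k) = \sum_i a i * w i (u k).
Proof.
move=> Wu; pose W := \matrix_(i < n, j < n) w i (u j).
have Wunit : W \in unitmx by rewrite unitmxE unitfE.
pose G := \row_j g (u j).
exists (fun i => (G *m invmx W) 0 i) => k.
have /rowP/(_ k) := mulmxKV Wunit G.
by rewrite !mxE => <-; apply: eq_bigr => i _; rewrite !mxE.
Qed.

(* Subtracting from [g] its interpolant in the span of [w] at the interior     *)
(* points leaves the three determinants unchanged, and they then involve only  *)
(* the values at the two extreme points.                                       *)
Lemma Phi_lift_gt0 (R : realType) (I : set R) (n : nat) (w : 'I_n -> R -> R)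
    (g : R -> R) (y : 'I_n.+2 -> R) (j : 'I_n.+2) :
  (0 < n)%N -> positive_Chebyshev I w -> sigma n.+2 I y ->
  0 < Phi (extend w g) (y \o lift ord0) ->
  0 < Phi (extend w g) (y \o lift ord_max) ->
  0 < Phi (extend w g) (y \o lift j).
Proof.
move=> n0 wC ys.
have [->//|j0] := eqVneq j ord0.
have [->//|jm] := eqVneq j ord_max.
have u_gt0 : 0 < Phi w (y \o lift ord0 \o lift ord_max).
  by apply: wC; do 2 apply: sigma_lift.
have [|a ga] := @Chebyshev_interpolation _ _ w (y \o lift ord0 \o lift ord_max) g.
  by rewrite gt_eqF.
pose h t := g t + (-1) * \sum_i a i * w i t.
have gh x : Phi (extend w g) x = Phi (extend w h) x.
  by rewrite Phi_extendD Phi_extend_span mulr0 addr0.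
have h0 (k : 'I_n.+2) : k != ord0 -> k != ord_max -> h (y k) = 0.
  rewrite eq_sym => /unlift_some[k1 -> _].
  rewrite (_ : ord_max = lift ord0 ord_max); last exact: val_inj.
  rewrite (inj_eq lift_inj) eq_sym => /unlift_some[k2 -> _].
  by rewrite /h (ga k2) mulN1r subrr.
rewrite !gh => L0 Lm.
have yl : y ord_max = y (lift ord0 ord_max) by congr y; exact: val_inj.
(* Once the least point is dropped, the new first point is interior in [y], where [h] vanishes, so
   only the greatest point contributes. [hb] is symmetric. *)
have hm : 0 < h (y ord_max).
  move: L0; rewrite Phi_extend_endpoints //=.
    rewrite h0 // ?mulr0 ?mul0r ?add0r; last by rewrite -val_eqE /= /bump /=; lia.
    by rewrite -yl pmulr_lgt0.
  move=> k k0 km; apply: h0; first by rewrite eq_sym neq_lift.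
  by move: km; rewrite -!val_eqE /= /bump; lia.
have hb : 0 < (-1) ^+ n * h (y ord0).
  move: Lm; rewrite Phi_extend_endpoints //=.
    rewrite (h0 (lift ord_max ord_max)) ?mul0r ?addr0 //; last 2 first.
    - by rewrite -val_eqE /= /bump; lia.
    - by rewrite -val_eqE /= /bump; lia.
    have -> : lift ord_max ord0 = ord0 :> 'I_n.+2.
      by apply: val_inj; rewrite /= /bump; lia.
    rewrite pmulr_lgt0 //; apply: wC; do 2 apply: sigma_lift; exact: ys.
  move=> k k0 km; apply: h0; move: k0 (ltn_ord k); rewrite -!val_eqE /= /bump; lia.
have jn : (0 < j <= n)%N.
  move: j0 jm (ltn_ord j); rewrite -!val_eqE /=; lia.
have l0 : lift j ord0 = ord0 :> 'I_n.+2 by apply: val_inj; rewrite /= /bump; lia.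
have lm : lift j ord_max = ord_max :> 'I_n.+2 by apply: val_inj; rewrite /= /bump; lia.
rewrite Phi_extend_endpoints //=; last first.
  by move=> k k0 km; apply: h0; [rewrite -l0|rewrite -lm]; rewrite (inj_eq lift_inj).
rewrite l0 lm addr_gt0 // mulr_gt0 //; apply: wC; do 2 apply: sigma_lift; exact: ys.
Qed.
Arguments Phi_lift_gt0 {R I n w g y} j.

(** * Refining a tuple by inserting points *)

Lemma sigma_insert (R : realType) (I : set R) (n : nat) (x : 'I_n.+1 -> R) (z : R) :
  is_interval I -> sigma n.+1 I x -> x ord0 < z < x ord_max ->
  (forall i, x i != z) ->
  exists (y : 'I_n.+2 -> R) (j : 'I_n.+2),
    [/\ sigma n.+2 I y, y \o lift j = x, y j = z, j != ord0 & j != ord_max].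
Proof.
move=> Iitv xs /andP[x0z zxm] xz.
have [Ix xlt] := xs.
pose P m := [exists i : 'I_n.+1, (i == m :> nat) && (z < x i)].
have exP : exists m, P m by exists n; apply/existsP; exists ord_max; rewrite eqxx.
(* The slot for [z] is the index of the first point exceeding it. *)
case: (ex_minnP exP) => m /existsP[im /andP[/eqP imm zim]] mmin.
have below (i : 'I_n.+1) : (i < m)%N -> x i < z.
  move=> ltim; rewrite ltNge le_eqVlt negb_or eq_sym xz /=; apply/negP => zi.
  have := mmin i; rewrite leqNgt ltim => /implyP; rewrite implybF => /negP; apply.
  by apply/existsP; exists i; rewrite eqxx.
have above (i : 'I_n.+1) : (m <= i)%N -> z < x i.
  by rewrite -imm => /(sigma_le xs); exact: lt_le_trans.
have m0 : (0 < m)%N.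
  rewrite lt0n; apply/eqP => m0; have := above ord0.
  by rewrite m0 => /(_ isT); rewrite ltNge ltW.
have mn : (m <= n)%N by rewrite -imm -ltnS.
pose j : 'I_n.+2 := Ordinal (n:=n.+2) (m:=m) (leqW mn : (m < n.+2)%N).
pose y k := if unlift j k is Some i then x i else z.
have yl i : y (lift j i) = x i by rewrite /y liftK.
have yj : y j = z by rewrite /y unlift_none.
exists y, j; split=> //.
- split=> [k|k l].
    rewrite /y; case: unlift => [i //|].
    by apply: (Iitv (x ord0) (x ord_max)) => //; rewrite !ltW.
  case: (unliftP j k) => [i ->|->]; case: (unliftP j l) => [i' ->|->].
  + by rewrite ltn_lift !yl; exact: xlt.
  + by rewrite yl yj => H; apply: below; move: H; rewrite /= /bump; lia.
  + by rewrite yl yj => H; apply: above; move: H; rewrite /= /bump; lia.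
  + by rewrite ltnn.
- by apply/funext.
- by rewrite -val_eqE /= -lt0n.
- by rewrite -val_eqE /=; lia.
Qed.
Arguments sigma_insert {R I n x z}.

(** The last clause is the invariant that makes insertion iterable: an old or new point can be lost
    only by ceasing to lie strictly between the extremes. *)
Lemma Phi_le0_refine1 (R : realType) (I : set R) (n : nat) (w : 'I_n -> R -> R)
    (g : R -> R) (x : 'I_n.+1 -> R) (z : R) :
  is_interval I -> (0 < n)%N -> positive_Chebyshev I w ->
  sigma n.+1 I x -> Phi (extend w g) x <= 0 ->
  exists x' : 'I_n.+1 -> R,
    [/\ sigma n.+1 I x', Phi (extend w g) x' <= 0,
        x ord0 <= x' ord0, x' ord_max <= x ord_max &
        forall t, t = z \/ (exists i, x i = t) ->
          x' ord0 < t < x' ord_max -> exists i, x' i = t].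
Proof.
move=> Iitv n0 wC xs xg.
have [[i <-]|zx] := pselect (exists i, x i = z).
  by exists x; split=> // t [->|//]; exists i.
have [zin|zout] := boolP (x ord0 < z < x ord_max); last first.
  by exists x; split=> // t [->|//] tin; rewrite tin in zout.
have {}zx i : x i != z by apply/eqP => xz; apply: zx; exists i.
have [y [j [ys yx yz j0 jm]]] := sigma_insert Iitv xs zin zx.
have l0 : lift j ord0 = ord0 :> 'I_n.+2.
  by apply: val_inj; move: j0; rewrite -val_eqE /= /bump; lia.
have lm : lift j ord_max = ord_max :> 'I_n.+2.
  by apply: val_inj; move: jm (ltn_ord j); rewrite -val_eqE /= /bump; lia.
have x0y : x ord0 = y ord0 by rewrite -yx /= l0.
have xmy : x ord_max = y ord_max by rewrite -yx /= lm.
have inj t : t = z \/ (exists i, x i = t) -> exists k, y k = t.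
  by move=> [->|[i <-]]; [exists j|exists (lift j i); rewrite -yx].
have [L0|L0] := leP (Phi (extend w g) (y \o lift ord0)) 0.
  exists (y \o lift ord0); split=> //=; first exact: sigma_lift.
  - by rewrite x0y; apply: (sigma_le ys).
  - by rewrite xmy; apply: (sigma_le ys); exact: leq_ord.
  move=> t /inj[k <-] /andP[tgt _].
  have [k0|] := eqVneq k ord0.
    by move: tgt; rewrite ltNge k0 (sigma_le ys).
  by rewrite eq_sym => /unlift_some[i -> _]; exists i.
have [Lm|Lm] := leP (Phi (extend w g) (y \o lift ord_max)) 0.
  exists (y \o lift ord_max); split=> //=; first exact: sigma_lift.
  - by rewrite x0y; apply: (sigma_le ys).
  - by rewrite xmy; apply: (sigma_le ys); exact: leq_ord.
  move=> t /inj[k <-] /andP[_ tlt].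
  have [km|] := eqVneq k ord_max.
    by move: tlt; rewrite ltNge km (sigma_le ys) //; exact: leq_ord.
  by rewrite eq_sym => /unlift_some[i -> _]; exists i.
(* If both omissions were positive, so would be the omission of [z], which gives back [x]. *)
by have := Phi_lift_gt0 j n0 wC ys L0 Lm; rewrite yx ltNge xg.
Qed.
Arguments Phi_le0_refine1 {R I n w g x} z.

Lemma Phi_le0_refine (R : realType) (I : set R) (n : nat) (w : 'I_n -> R -> R)
    (g : R -> R) (x : 'I_n.+1 -> R) (s : seq R) :
  is_interval I -> (0 < n)%N -> positive_Chebyshev I w ->
  sigma n.+1 I x -> Phi (extend w g) x <= 0 ->
  exists x' : 'I_n.+1 -> R,
    [/\ sigma n.+1 I x', Phi (extend w g) x' <= 0,
        x ord0 <= x' ord0, x' ord_max <= x ord_max &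
        forall t, t \in s -> x' ord0 < t < x' ord_max -> exists i, x' i = t].
Proof.
move=> Iitv n0 wC xs xg; elim: s => [|z s [x1 [x1s x1g x01 x1m x1in]]].
  by exists x; split.
have [x2 [x2s x2g x02 x2m x2in]] :=
  Phi_le0_refine1 z Iitv n0 wC x1s x1g.
exists x2; split=> //; [exact: le_trans x02 | exact: le_trans x1m |].
move=> t; rewrite in_cons => /orP ts tin; apply: x2in => //.
case: ts => [/eqP|ts]; [by left | right; apply: x1in => //].
by move: tin => /andP[lt gt]; rewrite (le_lt_trans x02) ?(lt_le_trans gt).
Qed.
Arguments Phi_le0_refine {R I n w g x} s.

(** After refinement by a grid of mesh [h], consecutive points differ by at most [h], since
    otherwise a grid point would lie strictly between them. The n gaps add up to n [h], and dividing
    [e] by n + 1 makes this strictly less than [e]. *)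
Lemma Phi_le0_shrink (R : realType) (I : set R) (n : nat) (w : 'I_n -> R -> R)
    (g : R -> R) (x : 'I_n.+1 -> R) (e : R) :
  is_interval I -> (0 < n)%N -> positive_Chebyshev I w -> 0 < e ->
  sigma n.+1 I x -> Phi (extend w g) x <= 0 ->
  exists x' : 'I_n.+1 -> R,
    [/\ sigma n.+1 I x', Phi (extend w g) x' <= 0,
        x ord0 <= x' ord0, x' ord_max <= x ord_max &
        x' ord_max - x' ord0 < e].
Proof.
move=> Iitv n0 wC e0 xs xg.
pose h := e / n.+1%:R.
have h0 : 0 < h by rewrite divr_gt0 // ltr0n.
pose a := x ord0; pose b := x ord_max.
pose s := [seq a + k%:R * h | k <- iota 0 (Num.truncn ((b - a) / h)).+1].
have [x' [xs' xg' x0 xm xin]] := Phi_le0_refine s Iitv n0 wC xs xg.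
exists x'; split=> //.
have gap (i j : 'I_n.+1) : j = i.+1 :> nat -> x' j - x' i <= h.
  move=> ji; rewrite leNgt; apply/negP => hgap.
  have ai : a <= x' i by apply: le_trans x0 _; exact: (sigma_le xs').
  have jb : x' j <= b.
    by apply: le_trans xm; apply: (sigma_le xs'); exact: leq_ord.
  (* Index of the first grid point strictly to the right of [x' i]. *)
  pose k := (Num.truncn ((x' i - a) / h)).+1.
  have qi : 0 <= (x' i - a) / h by rewrite divr_ge0 ?subr_ge0 // ltW.
  have /andP[kle klt] := truncn_itv qi.
  have hk : x' i < a + k%:R * h.
    by move: klt; rewrite ltr_pdivrMr // -/k => ?; lra.
  have kh : a + k%:R * h < x' j.
    move: kle; rewrite ler_pdivlMr // => ?.
    rewrite /k -natr1 mulrDl mul1r; lra.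
  have ks : a + k%:R * h \in s.
    apply/mapP; exists k => //; rewrite mem_iota /= add0n ltnS.
    have q0 : k%:R <= (b - a) / h by rewrite ler_pdivlMr //; lra.
    by rewrite truncn_ge_nat // (le_trans _ q0).
  have [] := xin _ ks.
    apply/andP; split.
      by apply: le_lt_trans hk; apply: (sigma_le xs').
    by apply: (lt_le_trans kh); apply: (sigma_le xs'); exact: leq_ord.
  move=> l xl; have [_ lt'] := xs'.
  have [li|il] := leqP l i.
    by have := sigma_le xs' li; rewrite xl leNgt hk.
  have jl : (j <= l)%N by rewrite ji.
  by have := sigma_le xs' jl; rewrite xl leNgt kh.
have bound m : forall i : 'I_n.+1, i = m :> nat -> x' i - x' ord0 <= m%:R * h.
  elim: m => [|m IH] i im.
    by rewrite (_ : i = ord0) ?subrr ?mul0r //; exact: val_inj.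
  have mlt : (m < n.+1)%N by rewrite ltnW // -im.
  have := IH (Ordinal mlt) erefl; have := gap (Ordinal mlt) i im.
  rewrite -natr1 mulrDl mul1r; lra.
apply: le_lt_trans (bound n ord_max erefl) _.
by rewrite /h mulrA ltr_pdivrMr ?ltr0n // mulrC ltr_pM2l // ltr_nat.
Qed.
Arguments Phi_le0_shrink {R I n w g x} e.

(** * Passage to a point and conclusion *)

Lemma nested_segments (R : realType) (a b : nat -> R) :
  (forall k, a k <= a k.+1) -> (forall k, b k.+1 <= b k) ->
  (forall k, a k <= b k) -> exists p, forall k, a k <= p <= b k.
Proof.
move=> ai bi ab.
have aD k d : a k <= a (k + d)%N.
  by elim: d => [|d IH]; rewrite ?addn0 // addnS (le_trans IH).
have bD k d : b (k + d)%N <= b k.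
  by elim: d => [|d IH]; rewrite ?addn0 // addnS (le_trans _ IH).
have abkl k l : a k <= b l.
  by apply: le_trans (aD k l) (le_trans (ab _) _); rewrite addnC.
exists (sup (range a)) => k; apply/andP; split.
  by apply: ub_le_sup; [exists (b 0%N) => _ [l _ <-] | exists k].
by apply: ge_sup; [exists (a 0%N), 0%N | move=> _ [l _ <-]].
Qed.

Lemma Phi_le0_at_point (R : realType) (I : set R) (n : nat)
    (w : 'I_n -> R -> R) (g : R -> R) (x : 'I_n.+1 -> R) :
  is_interval I -> (0 < n)%N -> positive_Chebyshev I w ->
  sigma n.+1 I x -> Phi (extend w g) x <= 0 ->
  exists2 p, I p & forall d, 0 < d -> exists x' : 'I_n.+1 -> R,
    [/\ sigma n.+1 I x', x' ord0 <= p, p <= x' ord_max,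
        x' ord_max - x' ord0 < d & Phi (extend w g) x' <= 0].
Proof.
move=> Iitv n0 wC xs xg.
pose bad (y : 'I_n.+1 -> R) := sigma n.+1 I y /\ Phi (extend w g) y <= 0.
(* The number in the pair is the step index, which sets the target length; on tuples that are not
   [bad] the value of [F] is arbitrary. *)
have /choice[F HF] (ky : nat * ('I_n.+1 -> R)) : exists y', bad ky.2 ->
    [/\ bad y', ky.2 ord0 <= y' ord0, y' ord_max <= ky.2 ord_max &
        y' ord_max - y' ord0 < ky.1.+1%:R^-1].
  have [[ys yg]|nb] := pselect (bad ky.2); last by exists ky.2.
  have [|y' [? ? ? ? ?]] :=
    Phi_le0_shrink ky.1.+1%:R^-1 Iitv n0 wC _ ys yg.
    by rewrite invr_gt0 ltr0n.
  by exists y'.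
pose X := fix X k := if k is l.+1 then F (l, X l) else x.
have Xbad k : bad (X k) by elim: k => [//|k /(HF (k, _))[]].
have HX k := HF (k, X k) (Xbad k).
have [|||p pX] := @nested_segments R (fun k => X k ord0) (fun k => X k ord_max).
- by move=> k; have [] := HX k.
- by move=> k; have [] := HX k.
- by move=> k; apply: (sigma_le (Xbad k).1).
exists p; first by apply: (Iitv (x ord0) (x ord_max) _ _ p (pX 0%N)); exact: xs.1.
(* [d^-1 < k + 1], and [X k.+1] has length below [1 / (k + 1)]. *)
move=> d d0; pose k := Num.truncn d^-1; exists (X k.+1).
have [[ys yg] _ _ yd] := HX k; have /andP[? ?] := pX k.+1; split=> //.
apply: lt_trans yd _; rewrite invf_plt ?posrE ?ltr0n //.
by have [|_ +] := andP (@truncn_itv R d^-1 _); rewrite // invr_ge0 ltW.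
Qed.
Arguments Phi_le0_at_point {R I n w g x}.

Lemma is_cvg_lower_Dinghas (R : realType) (I : set R) (n : nat)
    (w : 'I_n -> R -> R) (v : R -> R) (f : R -> R) (p : R) :
  cvg ((fun delta : R =>
          ereal_inf [set (divdiff w v f x)%:E | x in
            [set x | [/\ sigma n.+1 I x, x ord0 <= p, p <= x ord_max
                       & x ord_max - x ord0 < delta]]]) @ 0^'+).
Proof.
apply: nonincreasing_at_right_is_cvge; near=> e => d d' _ _ dd'.
apply: ereal_inf_le_tmp => _ [x [xs x0 xm xd] <-]; exists x => //; split=> //.
exact: lt_le_trans xd dd'.
Unshelve. all: by end_near. Qed.

Theorem corollary11 (R : realType) (I : set R) (n : nat)
    (w : 'I_n -> R -> R) (v : R -> R) (f : R -> R) :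
  nondegenerate_interval I ->
  (0 < n)%N ->
  positive_Chebyshev I w ->
  positive_Chebyshev I (extend w v) ->
  omega_convex I w f <->
  (forall p : R, I p -> (0 <= lower_Dinghas I w v f p)%E).
Proof.
move=> [Iitv _] n0 wC vC; split=> [fC p Ip|D0 x xs].
  apply: lime_ge; first exact: is_cvg_lower_Dinghas.
  near=> d; apply: le_ereal_inf_tmp => _ [x [xs _ _ _] <-].
  by rewrite lee_fin divr_ge0 ?fC // ltW // vC.
rewrite leNgt; apply/negP => fx.
(* Minus the divided difference of [f] at [x], so that [f + c v] has determinant exactly 0 there. *)
pose c := - Phi (extend w f) x / Phi (extend w v) x.
have c0 : 0 < c by rewrite divr_gt0 ?oppr_gt0 // vC.
have xg : Phi (extend w (fun t => f t + c * v t)) x <= 0.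
  by rewrite Phi_extendD /c divfK ?subrr // gt_eqF // vC.
have [p Ip pd] := Phi_le0_at_point Iitv n0 wC xs xg.
have := D0 p Ip; apply/negP; rewrite -ltNge.
apply: (@le_lt_trans _ _ (- c)%:E); last by rewrite lte_fin oppr_lt0.
apply: lime_le; first exact: is_cvg_lower_Dinghas.
near=> d; have d0 : 0 < d by near: d; exact: nbhs_right_gt.
have [y [ys y0 ym yd yg]] := pd d d0.
apply: (@le_trans _ _ (divdiff w v f y)%:E).
  by apply: ereal_inf_lbound; exists y.
by rewrite lee_fin /divdiff ler_pdivrMr ?vC // -subr_le0 mulNr opprK -Phi_extendD.
Unshelve. all: by end_near. Qed.
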